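(* Let $n_0 = n_x$, $n_1$, $n_f$ be positive integers, $W^0\in\mathbb{R}^{n_1\times n_0}$, $b^0\in\mathbb{R}^{n_1}$, $W^1\in\mathbb{R}^{n_f\times n_1}$, $b^1\in\mathbb{R}^{n_f}$, and let $\phi:\mathbb{R}^{n_1}\to\mathbb{R}^{n_1}$ be a function of the form $\phi(z)=[\varphi(z_1),\dots,\varphi(z_{n_1})]^\top$ with $\varphi:\mathbb{R}\to\mathbb{R}$. Consider the one-layer neural network $f:\mathbb{R}^{n_x}\to\mathbb{R}^{n_f}$, $$f(x)=W^1\phi(W^0x+b^0)+b^1 .$$ Let $\mathcal{X}\subset\mathbb{R}^{n_x}$ be a nonempty set satisfying the QC defined by a set $\mathcal{P}_{\mathcal{X}}\subset\mathbb{S}^{n_x+1}$, i.e., for every $P\in\mathcal{P}_{\mathcal{X}}$, $$\begin{bmatrix} x \\ 1 \end{bmatrix}^\top P\begin{bmatrix} x \\ 1 \end{bmatrix}\ge 0\quad\text{for all }x\in\mathcal{X}.$$ Let $\mathcal{Z}=\{z \mid z=W^0x+b^0,\ x\in\mathcal{X}\}$ and suppose $\phi$ satisfies the QC defined by a set $\mathcal{Q}_\phi\subset\mathbb{S}^{2n_1+1}$ on $\mathcal{Z}$, i.e., for every $Q\in\mathcal{Q}_\phi$, $$\begin{bmatrix} z \\ \phi(z) \\ 1 \end{bmatrix}^\top Q\begin{bmatrix} z \\ \phi(z) \\ 1 \end{bmatrix}\ge 0\quad\text{for all }z\in\mathcal{Z}.$$ Let $S\in\mathbb{S}^{n_x+n_f+1}$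 be a given symmetric matrix, and define $$M_{\mathrm{in}}(P)=\begin{bmatrix} I_{n_0} & 0 \\ 0 & 0 \\ 0 & 1 \end{bmatrix}P\begin{bmatrix} I_{n_0} & 0 & 0 \\ 0 & 0 & 1 \end{bmatrix},$$ $$M_{\mathrm{mid}}(Q)=\begin{bmatrix} {W^0}^\top & 0 & 0 \\ 0 & I_{n_1} & 0 \\ {b^0}^\top & 0 & 1 \end{bmatrix}Q\begin{bmatrix} W^0 & 0 & b^0 \\ 0 & I_{n_1} & 0 \\ 0 & 0 & 1 \end{bmatrix},$$ $$M_{\mathrm{out}}(S)=\begin{bmatrix} I_{n_0} & 0 & 0 \\ 0 & {W^1}^\top & 0 \\ 0 & {b^1}^\top & 1 \end{bmatrix}S\begin{bmatrix} I_{n_0} & 0 & 0 \\ 0 & W^1 & b^1 \\ 0 & 0 & 1 \end{bmatrix},$$ all of which are symmetric matrices of size $n_0+n_1+1$. If the matrix inequality $$M_{\mathrm{in}}(P)+M_{\mathrm{mid}}(Q)+M_{\mathrm{out}}(S)\preceq 0$$ holds for some $P\in\mathcal{P}_{\mathcal{X}}$ and $Q\in\mathcal{Q}_\phi$, then $$\begin{bmatrix} x \\ f(x) \\ 1 \end{bmatrix}^\top S\begin{bmatrix} x \\ f(x) \\ 1 \end{bmatrix}\le 0\quad\text{for all }x\in\mathcal{X}.$$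
   Context: $\mathbb{S}^m$ denotes the set of real symmetric $m\times m$ matrices; $A\preceq 0$ means that the symmetric matrix $A$ is negative semidefinite; $I_m$ is the $m\times m$ identity matrix. ''QC'' stands for quadratic constraint. *)

(* Defs.v *)
From mathcomp Require Import all_boot all_order all_algebra.
From mathcomp Require Import classical_sets reals.

Set Implicit Arguments.
Unset Strict Implicit.
Unset Printing Implicit Defensive.

Import Order.TTheory GRing.Theory Num.Theory.
Local Open Scope classical_set_scope.
Local Open Scope ring_scope.

Definition row3_mx {R : realType} {m n1 n2 n3 : nat}
    (A : 'M[R]_(m, n1)) (B : 'M[R]_(m, n2)) (C : 'M[R]_(m, n3)) :
    'M[R]_(m, n1 + n2 + n3) :=
  row_mx (row_mx A B) C.

Definition col3_mx {R : realType} {m1 m2 m3 n : nat}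
    (A : 'M[R]_(m1, n)) (B : 'M[R]_(m2, n)) (C : 'M[R]_(m3, n)) :
    'M[R]_(m1 + m2 + m3, n) :=
  col_mx (col_mx A B) C.

Definition qform {R : realType} {n : nat} (A : 'M[R]_n) (v : 'cV[R]_n) : R :=
  (v^T *m A *m v) 0 0.

Definition neg_semidef {R : realType} {n : nat} (A : 'M[R]_n) : Prop :=
  A \is symmetricmx /\ forall v : 'cV[R]_n, qform A v <= 0.

Definition set_satisfies_QC {R : realType} {n : nat}
    (X : set 'cV[R]_n) (PX : set 'M[R]_(n + 1)) : Prop :=
  forall P, PX P -> forall x, X x -> 0 <= qform P (col_mx x 1%:M).

Definition fun_satisfies_QC {R : realType} {n : nat}
    (phi : 'cV[R]_n -> 'cV[R]_n) (Z : set 'cV[R]_n)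
    (Qphi : set 'M[R]_(n + n + 1)) : Prop :=
  forall Q, Qphi Q -> forall z, Z z -> 0 <= qform Q (col3_mx z (phi z) 1%:M).

Section OneLayer.
Context {R : realType} {nx n1 nf : nat}.
Variables (W0 : 'M[R]_(n1, nx)) (b0 : 'cV[R]_n1).
Variables (W1 : 'M[R]_(nf, n1)) (b1 : 'cV[R]_nf).

Definition one_layer_nn (phi : 'cV[R]_n1 -> 'cV[R]_n1) (x : 'cV[R]_nx) :
    'cV[R]_nf :=
  W1 *m phi (W0 *m x + b0) + b1.

Definition preactivation_set (X : set 'cV[R]_nx) : set 'cV[R]_n1 :=
  [set W0 *m x + b0 | x in X].

Definition M_in (P : 'M[R]_(nx + 1)) : 'M[R]_(nx + n1 + 1) :=
  col3_mx (row_mx 1%:M 0)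
          (row_mx 0    0)
          (row_mx 0    1%:M)
  *m P *m
  col_mx (row3_mx 1%:M 0 0)
         (row3_mx 0    0 1%:M).

Definition M_mid (Q : 'M[R]_(n1 + n1 + 1)) : 'M[R]_(nx + n1 + 1) :=
  col3_mx (row3_mx W0^T 0    0)
          (row3_mx 0    1%:M 0)
          (row3_mx b0^T 0    1%:M)
  *m Q *m
  col3_mx (row3_mx W0 0    b0)
          (row3_mx 0  1%:M 0)
          (row3_mx 0  0    1%:M).

Definition M_out (S : 'M[R]_(nx + nf + 1)) : 'M[R]_(nx + n1 + 1) :=
  col3_mx (row3_mx 1%:M 0    0)
          (row3_mx 0    W1^T 0)
          (row3_mx 0    b1^T 1%:M)
  *m S *m
  col3_mx (row3_mx 1%:M 0  0)
          (row3_mx 0    W1 b1)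
          (row3_mx 0    0  1%:M).

End OneLayer.

(* Main.v *)
Require Import Defs.
From mathcomp Require Import all_boot all_order all_algebra.
From mathcomp Require Import classical_sets reals.

Import Order.TTheory GRing.Theory Num.Theory.
Local Open Scope classical_set_scope.
Local Open Scope ring_scope.

(** Each of the three matrices is a congruence [T^T *m _ *m T], where [T] is a
    selection or affine-layer matrix.  Congruence preserves symmetry, and it
    pulls a quadratic form back along [T]: the form of [T^T *m A *m T] at [v]
    is the form of [A] at [T *m v].  Evaluate all three at the single vector
    [v = (x, phi z, 1)], where [z = W0 x + b0].  The transforms send [v] to
    [(x, 1)], [(z, phi z, 1)] and [(x, f x, 1)] respectively, so the sum of the
    three matrices has at [v] the value
      [qform P (x, 1) + qform Q (z, phi z, 1) + qform S (x, f x, 1)].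
    This is at most 0 by the matrix inequality, while its first two terms are
    nonnegative by the quadratic constraints; hence the third is at most 0.
    The two facts on congruence are [symmetricmx_congr] and [qform_congr]; the
    block identities [M_inE], [M_midE] and [M_outE] exhibit the transforms. *)

Lemma qformD (R : realType) n (A B : 'M[R]_n) v :
  qform (A + B) v = qform A v + qform B v.
Proof. by rewrite /qform mulmxDr mulmxDl mxE. Qed.

Lemma qform_congr (R : realType) m n (T : 'M[R]_(m, n)) (A : 'M[R]_m) v :
  qform (T^T *m A *m T) v = qform A (T *m v).
Proof. by rewrite /qform trmx_mul !mulmxA. Qed.

Lemma symmetricmxP (R : realType) n (A : 'M[R]_n) :
  reflect (A = A^T) (A \is symmetricmx).
Proof.
by rewrite is_hermitianmxE expr0 scale1r map_mx_id //; exact: eqP.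
Qed.

Lemma symmetricmx_congr (R : realType) m n (T : 'M[R]_(m, n)) (A : 'M[R]_m) :
  A \is symmetricmx -> T^T *m A *m T \is symmetricmx.
Proof.
move=> /symmetricmxP AT; apply/symmetricmxP.
by rewrite !trmx_mul trmxK -AT mulmxA.
Qed.

Lemma mul_row3_col3 (R : realType) m n1 n2 n3 p
    (A1 : 'M[R]_(m, n1)) (A2 : 'M_(m, n2)) (A3 : 'M_(m, n3))
    (B1 : 'M_(n1, p)) (B2 : 'M_(n2, p)) (B3 : 'M_(n3, p)) :
  row3_mx A1 A2 A3 *m col3_mx B1 B2 B3 = A1 *m B1 + A2 *m B2 + A3 *m B3.
Proof. by rewrite /row3_mx /col3_mx !mul_row_col. Qed.

Lemma mul_col3_mx (R : realType) m1 m2 m3 n p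
    (A1 : 'M[R]_(m1, n)) (A2 : 'M_(m2, n)) (A3 : 'M_(m3, n)) (B : 'M_(n, p)) :
  col3_mx A1 A2 A3 *m B = col3_mx (A1 *m B) (A2 *m B) (A3 *m B).
Proof. by rewrite /col3_mx !mul_col_mx. Qed.

Lemma tr_row3_mx (R : realType) m n1 n2 n3
    (A1 : 'M[R]_(m, n1)) (A2 : 'M_(m, n2)) (A3 : 'M_(m, n3)) :
  (row3_mx A1 A2 A3)^T = col3_mx A1^T A2^T A3^T.
Proof. by rewrite /row3_mx /col3_mx !tr_row_mx. Qed.

Lemma tr_col3_mx (R : realType) m1 m2 m3 n
    (A1 : 'M[R]_(m1, n)) (A2 : 'M_(m2, n)) (A3 : 'M_(m3, n)) :
  (col3_mx A1 A2 A3)^T = row3_mx A1^T A2^T A3^T.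
Proof. by rewrite /row3_mx /col3_mx !tr_col_mx. Qed.

(** Block matrices can be assembled by columns or by rows.  Transposition
    turns a column of rows into a row of columns, so this exchange is what
    brings a transposed transform back to the row-wise form of the left
    factors of [M_in], [M_mid] and [M_out]. *)
Lemma row_col3_mx (R : realType) m1 m2 m3 n1 n2
    (A1 : 'M[R]_(m1, n1)) (A2 : 'M_(m2, n1)) (A3 : 'M_(m3, n1))
    (B1 : 'M_(m1, n2)) (B2 : 'M_(m2, n2)) (B3 : 'M_(m3, n2)) :
  row_mx (col3_mx A1 A2 A3) (col3_mx B1 B2 B3) =
  col3_mx (row_mx A1 B1) (row_mx A2 B2) (row_mx A3 B3).
Proof.
by rewrite /col3_mx -block_mxEh block_mxEv -block_mxEh block_mxEv.
Qed.

Lemma row3_col3_mx (R : realType) m1 m2 m3 n1 n2 n3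
    (A1 : 'M[R]_(m1, n1)) (A2 : 'M_(m2, n1)) (A3 : 'M_(m3, n1))
    (B1 : 'M_(m1, n2)) (B2 : 'M_(m2, n2)) (B3 : 'M_(m3, n2))
    (C1 : 'M_(m1, n3)) (C2 : 'M_(m2, n3)) (C3 : 'M_(m3, n3)) :
  row3_mx (col3_mx A1 A2 A3) (col3_mx B1 B2 B3) (col3_mx C1 C2 C3) =
  col3_mx (row3_mx A1 B1 C1) (row3_mx A2 B2 C2) (row3_mx A3 B3 C3).
Proof. by rewrite {1}/row3_mx !row_col3_mx. Qed.

Section Transforms.
Context {R : realType} {nx n1 nf : nat}.
Variables (W0 : 'M[R]_(n1, nx)) (b0 : 'cV[R]_n1).
Variables (W1 : 'M[R]_(nf, n1)) (b1 : 'cV[R]_nf).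

Definition in_transform : 'M[R]_(nx + 1, nx + n1 + 1) :=
  col_mx (row3_mx 1%:M 0 0) (row3_mx 0 0 1%:M).

Definition mid_transform : 'M[R]_(n1 + n1 + 1, nx + n1 + 1) :=
  col3_mx (row3_mx W0 0 b0) (row3_mx 0 1%:M 0) (row3_mx 0 0 1%:M).

Definition out_transform : 'M[R]_(nx + nf + 1, nx + n1 + 1) :=
  col3_mx (row3_mx 1%:M 0 0) (row3_mx 0 W1 b1) (row3_mx 0 0 1%:M).

Lemma M_inE P : M_in (n1 := n1) P = in_transform^T *m P *m in_transform.
Proof.
by rewrite /in_transform tr_col_mx !tr_row3_mx row_col3_mx !trmx0 !trmx1.
Qed.

Lemma M_midE Q : M_mid W0 b0 Q = mid_transform^T *m Q *m mid_transform.
Proof.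
by rewrite /mid_transform tr_col3_mx !tr_row3_mx row3_col3_mx !trmx0 !trmx1.
Qed.

Lemma M_outE S : M_out W1 b1 S = out_transform^T *m S *m out_transform.
Proof.
by rewrite /out_transform tr_col3_mx !tr_row3_mx row3_col3_mx !trmx0 !trmx1.
Qed.

Lemma in_transform_col3 (x : 'cV[R]_nx) (y : 'cV_n1) :
  in_transform *m col3_mx x y 1%:M = col_mx x 1%:M.
Proof.
by rewrite mul_col_mx !mul_row3_col3 !mul0mx !mul1mx !addr0 !add0r.
Qed.

Lemma mid_transform_col3 (x : 'cV[R]_nx) (y : 'cV_n1) :
  mid_transform *m col3_mx x y 1%:M = col3_mx (W0 *m x + b0) y 1%:M.
Proof.
by rewrite mul_col3_mx !mul_row3_col3 !mul0mx !mul1mx mulmx1 !addr0 !add0r.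
Qed.

Lemma out_transform_col3 (x : 'cV[R]_nx) (y : 'cV_n1) :
  out_transform *m col3_mx x y 1%:M = col3_mx x (W1 *m y + b1) 1%:M.
Proof.
by rewrite mul_col3_mx !mul_row3_col3 !mul0mx !mul1mx mulmx1 !addr0 !add0r.
Qed.

End Transforms.

Theorem theorem1 (R : realType) (nx n1 nf : nat)
    (nx_gt0 : (0 < nx)%N) (n1_gt0 : (0 < n1)%N) (nf_gt0 : (0 < nf)%N)
    (W0 : 'M[R]_(n1, nx)) (b0 : 'cV[R]_n1)
    (W1 : 'M[R]_(nf, n1)) (b1 : 'cV[R]_nf)
    (varphi : R -> R) (phi : 'cV[R]_n1 -> 'cV[R]_n1)
    (phiE : forall z i, phi z i 0 = varphi (z i 0))
    (X : set 'cV[R]_nx) (X_neq0 : X !=set0)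
    (PX : set 'M[R]_(nx + 1))
    (PX_sym : forall P, PX P -> P \is symmetricmx)
    (X_QC : set_satisfies_QC X PX)
    (Qphi : set 'M[R]_(n1 + n1 + 1))
    (Qphi_sym : forall Q, Qphi Q -> Q \is symmetricmx)
    (phi_QC : fun_satisfies_QC phi (preactivation_set W0 b0 X) Qphi)
    (S : 'M[R]_(nx + nf + 1)) (S_sym : S \is symmetricmx) :
  [/\ forall P, PX P -> M_in (n1 := n1) P \is symmetricmx,
      forall Q, Qphi Q -> M_mid W0 b0 Q \is symmetricmx
    & M_out W1 b1 S \is symmetricmx] /\
  ((exists P Q, [/\ PX P, Qphi Q
      & neg_semidef (M_in P + M_mid W0 b0 Q + M_out W1 b1 S)]) ->
   forall x, X x ->
     qform S (col3_mx x (one_layer_nn W0 b0 W1 b1 phi x) 1%:M) <= 0).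
Proof.
split.
  split=> [P /PX_sym Psym|Q /Qphi_sym Qsym|].
  - by rewrite M_inE; exact: symmetricmx_congr.
  - by rewrite M_midE; exact: symmetricmx_congr.
  - by rewrite M_outE; exact: symmetricmx_congr.
case=> P [Q [PXP QphiQ [_ M_le0]]] x Xx.
set z := W0 *m x + b0.
have Zz : preactivation_set W0 b0 X z by exists x.
have P_ge0 := X_QC P PXP x Xx.
have Q_ge0 := phi_QC Q QphiQ z Zz.
have := M_le0 (col3_mx x (phi z) 1%:M).
rewrite !qformD M_inE M_midE M_outE !qform_congr.
rewrite in_transform_col3 mid_transform_col3 out_transform_col3.
by apply: le_trans; rewrite lerDr addr_ge0.
Qed.
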